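(* Let $\Gamma$ be a non-amenable group. Then there exists $p>1$ such that $T_1(\Gamma)\nsubseteq \ell^p(\Gamma)$.
   Context: For a group $\Gamma$, the space $T_1(\Gamma)$ of Littlewood functions is the space of all functions $f\colon\Gamma\to\mathbf{C}$ for which there exist $f_1,f_2\colon\Gamma\times\Gamma\to\mathbf{C}$ with $f(x^{-1}y)=f_1(x,y)+f_2(x,y)$ for all $x,y\in\Gamma$, such that $\sup_x\sum_y|f_1(x,y)|<\infty$ and $\sup_y\sum_x|f_2(x,y)|<\infty$. *)

(* Defs.v *)
From HB Require Import structures.
From mathcomp Require Import all_boot all_order all_algebra.
From mathcomp Require Import all_classical all_reals all_analysis.
From mathcomp Require Import complex.
Set Implicit Arguments. Unset Strict Implicit. Unset Printing Implicit Defensive.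
Import Order.TTheory GRing.Theory Num.Theory.
Local Open Scope classical_set_scope.
Local Open Scope ring_scope.

Definition cmod (R : realType) (z : R[i]) : R := Normc.normc z.

Definition ltrans (G : groupType) (g : G) (A : set G) : set G :=
  [set (g * a)%g | a in A].

Definition amenable (R : realType) (G : groupType) : Prop :=
  exists m : set G -> R,
    [/\ m setT = 1,
        (forall A, 0 <= m A),
        (forall A B, A `&` B = set0 -> m (A `|` B) = m A + m B) &
        (forall g A, m (ltrans g A) = m A)].

Definition littlewood (R : realType) (G : groupType) (f : G -> R[i]) : Prop :=
  exists f1 f2 : G -> G -> R[i],
    [/\ (forall x y, f ((x^-1 * y)%g) = f1 x y + f2 x y),
        (exists C : R, forall x,
            (\esum_(y in [set: G]) (cmod (f1 x y))%:E <= C%:E)%E) &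
        (exists C : R, forall y,
            (\esum_(x in [set: G]) (cmod (f2 x y))%:E <= C%:E)%E)].

Definition in_lp (R : realType) (G : groupType) (p : R) (f : G -> R[i]) : Prop :=
  (\esum_(x in [set: G]) ((cmod (f x)) `^ p)%:E < +oo)%E.

(* Main.v *)
(** A finitely supported [psi >= 0] almost invariant under right translations
    yields an almost invariant density, and an ultrafilter limit of such densities
    is an invariant mean.  Applied to [psi = phi^2 / |phi|_2^2], this shows that on
    a non-amenable group some averaging operator over a finite symmetric set [S]
    has [l^2]-norm at most [rho < 1], so the [n]-step transition probabilities
    satisfy [u_n <= rho^n].

    For [q > rho] put [g_q = sum_n q^-n u_n].  Choose [rho < r < q < 1].  The
    function [h = g_r] satisfies [avg h <= r h], hence
    [sum_y g_q(x^-1 y) h(y) <= h(x) / (1 - r/q)].  Splitting the kernel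
    [g_q(x^-1 y)] according to whether [h x <= h y] or not therefore bounds the rows
    of the first part and, [g_q] being symmetric, the columns of the second one, by
    [1 / (1 - r/q)]: [g_q] is a Littlewood function.

    On its support [u_n >= k^-n] with [k = #|S|], and [sum_x u_n(x) = 1], so
    [|g_q|_p^p >= (q^-1 k^-(p-1))^n] for all [n]; this is unbounded as soon as
    [k^(p-1) < q^-1]. *)
Require Import Defs.
From mathcomp Require Import all_boot all_order all_algebra.
From mathcomp Require Import all_classical all_reals all_analysis.
From mathcomp Require Import complex.
From mathcomp Require Import ring lra.
Import Order.TTheory GRing.Theory Num.Theory.
Import numFieldNormedType.Exports.
Local Open Scope ring_scope.
Set Implicit Arguments. Unset Strict Implicit. Unset Printing Implicit Defensive.

(** * Finitely supported functions on a group and their sums *)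

Section FinitelySupportedFunctions.
Local Open Scope classical_set_scope.
Variables (R : realType) (G : groupType).
Implicit Types (F H : G -> R) (X : seq G).

Definition finsupp F := exists X, forall x, x \notin X -> F x = 0.
Definition total F := \sum_(x \in [set: G]) F x.

Lemma total_seq X F : uniq X -> (forall x, x \notin X -> F x = 0) ->
  total F = \sum_(x <- X) F x.
Proof.
move=> uX FX; rewrite /total (fsbigE X) //; last by move=> x _; exact: FX.
by apply: eq_bigl => x; rewrite in_setT.
Qed.

Lemma finsuppW F H : finsupp F -> (forall x, F x = 0 -> H x = 0) -> finsupp H.
Proof. by move=> [X FX] FH; exists X => x /FX/FH. Qed.

Lemma finsuppD F H : finsupp F -> finsupp H -> finsupp (fun x => F x + H x).
Proof.
move=> [X FX] [Y HY]; exists (X ++ Y) => x.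
by rewrite mem_cat negb_or => /andP[/FX -> /HY ->]; rewrite addr0.
Qed.

Lemma finsuppM F H : finsupp F -> finsupp (fun x => F x * H x).
Proof. by move=> FF; apply: finsuppW FF _ => x ->; rewrite mul0r. Qed.

Lemma finsuppZ a F : finsupp F -> finsupp (fun x => a * F x).
Proof. by move=> FF; apply: finsuppW FF _ => x ->; rewrite mulr0. Qed.

Lemma finsupp_sum (I : Type) (s : seq I) (F : I -> G -> R) :
  (forall i, finsupp (F i)) -> finsupp (fun x => \sum_(i <- s) F i x).
Proof.
move=> FF; elim: s => [|i s IH].
  by exists [::] => x _; rewrite big_nil.
apply: finsuppW (finsuppD (FF i) IH) _ => x.
by rewrite big_cons.
Qed.

Lemma finsuppS g F : finsupp F -> finsupp (fun x => F (x * g)%g).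
Proof.
move=> [X FX]; exists [seq (x * g^-1)%g | x <- X] => x xX.
apply: FX; apply: contra xX => xX.
by apply/mapP; exists (x * g)%g => //; rewrite mulgK.
Qed.

Lemma finsupp_uniq F : finsupp F ->
  exists2 X, uniq X & forall x, x \notin X -> F x = 0.
Proof.
move=> [X FX]; exists (undup X); first exact: undup_uniq.
by move=> x; rewrite mem_undup => /FX.
Qed.

Lemma totalD F H : finsupp F -> finsupp H ->
  total (fun x => F x + H x) = total F + total H.
Proof.
move=> [X FX] [Y HY]; pose Z := undup (X ++ Y).
have uZ : uniq Z by exact: undup_uniq.
have FZ x : x \notin Z -> F x = 0.
  by rewrite mem_undup mem_cat negb_or => /andP[/FX].
have HZ x : x \notin Z -> H x = 0.
  by rewrite mem_undup mem_cat negb_or => /andP[_ /HY].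
rewrite (total_seq uZ FZ) (total_seq uZ HZ) -big_split /=.
by apply: total_seq => // x xZ; rewrite FZ // HZ // addr0.
Qed.

Lemma totalZ a F : total (fun x => a * F x) = a * total F.
Proof. by rewrite /total mulr_fsumr. Qed.

Lemma total_ge0 F : (forall x, 0 <= F x) -> 0 <= total F.
Proof. by move=> F0; apply: fsumr_ge0 => x _; exact: F0. Qed.

Lemma eq_total F H : F =1 H -> total F = total H.
Proof. by move=> /funext ->. Qed.

Lemma ler_total F H : finsupp F -> finsupp H -> (forall x, F x <= H x) ->
  total F <= total H.
Proof.
move=> FF FH FleH; rewrite -subr_ge0 -mulN1r -totalZ -totalD //; last first.
  exact: finsuppZ.
by apply: total_ge0 => x; rewrite mulN1r subr_ge0.
Qed.

Lemma total_sum (I : Type) (s : seq I) (F : I -> G -> R) :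
  (forall i, finsupp (F i)) ->
  total (fun x => \sum_(i <- s) F i x) = \sum_(i <- s) total (F i).
Proof.
move=> FF; elim: s => [|i s IH].
  by rewrite big_nil (@total_seq [::]) ?big_nil // => x _; rewrite big_nil.
rewrite big_cons -IH -totalD //; last exact: finsupp_sum.
by apply: eq_total => x; rewrite big_cons.
Qed.

Lemma totalS g F : total (fun x => F (x * g)%g) = total F.
Proof.
rewrite /total [RHS](@reindex_fsbigT _ _ _ _ _ (fun x : G => (x * g)%g)) //.
by exists (fun x => (x * g^-1)%g) => x; rewrite ?mulgK ?mulgKV // mulgVK.
Qed.

Lemma ler_sum_total X F : uniq X -> finsupp F -> (forall x, 0 <= F x) ->
  \sum_(x <- X) F x <= total F.
Proof.
move=> uX [Y FY] F0; pose Z := undup (X ++ Y).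
rewrite (@total_seq Z) ?undup_uniq //; last first.
  by move=> x; rewrite mem_undup mem_cat negb_or => /andP[_ /FY].
rewrite [leRHS](bigID (mem X)) /= -[leLHS]addr0 lerD ?sumr_ge0 //.
rewrite -[leRHS]big_filter le_eqVlt; apply/orP; left; apply/eqP.
apply: perm_big; apply: uniq_perm => //.
  by rewrite filter_uniq // undup_uniq.
by move=> x; rewrite mem_filter mem_undup mem_cat; case: (x \in X).
Qed.

Lemma ler_total1 x F : finsupp F -> (forall x, 0 <= F x) -> F x <= total F.
Proof.
by move=> FF F0; have := @ler_sum_total [:: x] F isT FF F0; rewrite big_seq1.
Qed.

End FinitelySupportedFunctions.

(** * Averaging operators in [l^2] and almost invariance *)

Definition avg (R : realType) (G : groupType) (S : seq G) (phi : G -> R) x :=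
  (size S)%:R^-1 * \sum_(s <- S) phi (x * s)%g.

Lemma finsupp_avg (R : realType) (G : groupType) (S : seq G) (phi : G -> R) :
  finsupp phi -> finsupp (avg S phi).
Proof.
by move=> Fphi; apply: finsuppZ; apply: finsupp_sum => s; exact: finsuppS.
Qed.

Lemma ler_bigsum_mem (R : realType) (I : eqType) (s : seq I) (F : I -> R) i :
  i \in s -> (forall j, 0 <= F j) -> F i <= \sum_(j <- s) F j.
Proof. by move=> si F0; rewrite (big_rem i) //= lerDl sumr_ge0. Qed.

(** Expanding the square leaves only correlations of pairs of translates, which can be compared with
    their distances. *)
Lemma total_sqr_avg (R : realType) (G : groupType) (S : seq G) (phi : G -> R) :
  finsupp phi -> (0 < size S)%N ->
  (size S)%:R ^+ 2 * total (fun x => avg S phi x ^+ 2) =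
  \sum_(s <- S) \sum_(t <- S) total (fun x => phi (x * s)%g * phi (x * t)%g).
Proof.
move=> Fphi S0; have k0 : (size S)%:R != 0 :> R by rewrite pnatr_eq0 -lt0n.
rewrite -totalZ.
have Fprod s t : finsupp (fun x => phi (x * s)%g * phi (x * t)%g).
  by apply: finsuppM; exact: finsuppS.
transitivity (\sum_(s <- S)
    total (fun x => \sum_(t <- S) phi (x * s)%g * phi (x * t)%g)); last first.
  by apply: eq_bigr => s _; rewrite total_sum.
rewrite -total_sum; last first.
  by move=> s; exact: finsupp_sum.
apply: eq_total => x; rewrite /avg exprMn mulrA -exprMn divff // expr1n mul1r.
by rewrite expr2 mulr_suml; apply: eq_bigr => s _; rewrite mulr_sumr.
Qed.

(* The norm of the average of the translates of [phi] is close to that of [phi]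
   only if all translates are close to each other; [|a^2 - b^2|] is then
   controlled by [(a - b)^2] and [(a + b)^2] through AM-GM. *)
Lemma almost_invariant_sqr (R : realType) (G : groupType) (S : seq G)
    (phi : G -> R) (eps : R) (s : G) :
  finsupp phi -> (1%g \in S) -> s \in S -> 0 < eps ->
  (1 - eps ^+ 2 / (8 * (size S)%:R ^+ 2)) * total (fun x => phi x ^+ 2) <=
    total (fun x => avg S phi x ^+ 2) ->
  total (fun x => `|phi (x * s)%g ^+ 2 - phi x ^+ 2|) <=
    eps * total (fun x => phi x ^+ 2).
Proof.
move=> Fphi S1 Ss eps0; set a := total _; set k : R := (size S)%:R => le_avg.
have S0 : (0 < size S)%N by case: (S) S1.
have k0 : 0 < k by rewrite ltr0n.
have Fsq t : finsupp (fun x => phi (x * t)%g ^+ 2).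
  by apply: finsuppW (finsuppS t Fphi) _ => x ->; rewrite expr0n.
have totsq t : total (fun x => phi (x * t)%g ^+ 2) = a.
  exact: (totalS t (fun x => phi x ^+ 2)).
have Fprod t u : finsupp (fun x => phi (x * t)%g * phi (x * u)%g).
  by apply: finsuppM; exact: finsuppS.
(* All translates have the same squared norm [a], so [D t u] is half the squared distance of two of
   them. *)
pose D t u := a - total (fun x => phi (x * t)%g * phi (x * u)%g).
have combE (b : R) t u :
    total (fun x => (phi (x * t)%g + b * phi (x * u)%g) ^+ 2) =
    a + (2 * b) * total (fun x => phi (x * t)%g * phi (x * u)%g) + b ^+ 2 * a.
  transitivity (total (fun x => (phi (x * t)%g ^+ 2 +
      (2 * b) * (phi (x * t)%g * phi (x * u)%g)) + b ^+ 2 * phi (x * u)%g ^+ 2)).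
    by apply: eq_total => x; ring.
  have F2 := finsuppZ (2 * b) (Fprod t u); have F3 := finsuppZ (b ^+ 2) (Fsq u).
  by rewrite !totalD ?totalZ ?totsq //; exact: finsuppD.
have DE t u : total (fun x => (phi (x * t)%g - phi (x * u)%g) ^+ 2) = 2 * D t u.
  rewrite (_ : (fun _ => _) =
    fun x => (phi (x * t)%g + (-1) * phi (x * u)%g) ^+ 2); last first.
    by apply/funext => x; rewrite mulN1r.
  by rewrite combE /D; ring.
have D0 t u : 0 <= D t u.
  have : 0 <= 2 * D t u by rewrite -DE; apply: total_ge0 => x; exact: sqr_ge0.
  by rewrite pmulr_rge0.
have sumD : \sum_(t <- S) \sum_(u <- S) D t u =
    k ^+ 2 * (a - total (fun x => avg S phi x ^+ 2)).
  rewrite mulrBr total_sqr_avg //.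
  under eq_bigr do rewrite sumrB.
  rewrite sumrB; congr (_ - _).
  rewrite !big_const_seq !count_predT !iter_addr !addr0 -mulrnA.
  by rewrite -[RHS]mulrC -natrX mulr_natr expnS expn1.
(* One nonnegative term is at most the whole double sum; its factor [k ^+ 2] cancels the one in the
   hypothesis. *)
have leD : D s 1%g <= eps ^+ 2 / 8 * a.
  apply: (@le_trans _ _ (\sum_(t <- S) \sum_(u <- S) D t u)).
    apply: (@le_trans _ _ (\sum_(u <- S) D s u)).
      exact: ler_bigsum_mem.
    apply: (@ler_bigsum_mem _ _ _ (fun t => \sum_(u <- S) D t u)) => // t.
    exact: sumr_ge0.
  rewrite sumD -ler_pdivlMl ?exprn_gt0 //.
  rewrite lerBlDr -lerBlDl; apply: le_trans le_avg.
  rewrite le_eqVlt; apply/orP; left; apply/eqP.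
  by rewrite -/k; field; rewrite gt_eqF.
(* The AM-GM weights are chosen so that, after summation, each of the two terms is at most
   [eps / 2 * a]. *)
have ptw x : `|phi (x * s)%g ^+ 2 - phi x ^+ 2| <=
    2 / eps * (phi (x * s)%g - phi (x * 1)%g) ^+ 2 +
    eps / 8 * (phi (x * s)%g + 1 * phi (x * 1)%g) ^+ 2.
  rewrite mulg1 mul1r subr_sqr normrM.
  rewrite -[X in _ <= _ * X + _]real_normK ?num_real //.
  rewrite -[X in _ <= _ + _ * X]real_normK ?num_real //.
  set b := `|_ - _|; set c := `|_ + _|.
  rewrite -subr_ge0.
  rewrite (_ : _ - _ = 2 / eps * (b - eps / 4 * c) ^+ 2).
    by rewrite mulr_ge0 ?sqr_ge0 // divr_ge0 // ltW.
  by field; rewrite gt_eqF.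
have Fd t u (b : R) : finsupp (fun x => (phi (x * t)%g + b * phi (x * u)%g) ^+ 2).
  have : finsupp (fun x => phi (x * t)%g + b * phi (x * u)%g).
    by apply: finsuppD; [exact: finsuppS|apply: finsuppZ; exact: finsuppS].
  by move=> /finsuppW; apply => x ->; rewrite expr0n.
have Fd' t u : finsupp (fun x => (phi (x * t)%g - phi (x * u)%g) ^+ 2).
  by apply: finsuppW (Fd t u (-1)) _ => x; rewrite mulN1r.
apply: le_trans (ler_total _ _ ptw) _.
- have : finsupp (fun x => phi (x * s)%g ^+ 2 + (-1) * phi x ^+ 2).
    apply: finsuppD => //; apply: finsuppZ.
    by apply: finsuppW Fphi _ => x ->; rewrite expr0n.
  by move=> /finsuppW; apply => x; rewrite mulN1r => ->; rewrite normr0.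
- by apply: finsuppD; apply: finsuppZ.
rewrite totalD; [|exact: finsuppZ..].
rewrite !totalZ DE combE.
have -> : 2 / eps * (2 * D s 1%g) + eps / 8 * (a + 2 * 1 *
   total (fun x => phi (x * s)%g * phi (x * 1)%g) + 1 ^+ 2 * a)
  = (4 / eps - eps / 4) * D s 1%g + eps / 2 * a.
  by rewrite /D; field; rewrite gt_eqF.
apply: (@le_trans _ _ (4 / eps * D s 1%g + eps / 2 * a)).
  by rewrite lerD2r ler_wpM2r // lerBlDr lerDl divr_ge0 // ltW.
apply: (@le_trans _ _ (4 / eps * (eps ^+ 2 / 8 * a) + eps / 2 * a)).
  by rewrite lerD2r ler_wpM2l // divr_ge0 // ltW.
by rewrite le_eqVlt; apply/orP; left; apply/eqP; field; rewrite gt_eqF.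
Qed.

(** * From almost invariant densities to an invariant mean *)

Section Reiter.
Local Open Scope classical_set_scope.
Local Open Scope ring_scope.

(** Compactness of the segment gives a cluster point. An ultrafilter contains the preimage of each
    neighbourhood or of its complement, and clustering excludes the latter. *)
Lemma ultra_bounded_cvg (R : realType) (I : Type) (U : set_system I)
    (f : I -> R) (a b : R) :
  UltraFilter U -> (forall i, a <= f i <= b) -> exists l : R, f @ U --> l.
Proof.
move=> UU fab.
have [l [_ cl]] : (`[a, b]%classic `&` cluster (f @ U) !=set0)%classic.
  apply: (@segment_compact R a b (f @ U) _ _).
  by apply: (@filterE I U) => i; rewrite /= in_itv; exact: fab.
exists l => V Vl.
have [//|UnV] := in_ultra_setVsetC (f @^-1` V)%classic UU.
by have [x [/= nVx /nVx]] := cl (~` V)%classic V UnV Vl.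
Qed.

Variables (R : realType) (G : groupType).

(* [density psi A] is the mass of the inverse of [A], so that left translation of
   [A] becomes right translation of [psi]. *)
Definition density (psi : G -> R) (A : set G) : R :=
  total (fun x => psi x * (\1_A (x^-1)%g : R)).

Lemma finsupp_density psi (A : set G) : finsupp psi ->
  finsupp (fun x => psi x * (\1_A (x^-1)%g : R)).
Proof. exact: finsuppM. Qed.

Lemma densityT psi : density psi setT = total psi.
Proof. by apply: eq_total => x; rewrite indicE in_setT mulr1. Qed.

Lemma density_ge0 psi A : (forall x, 0 <= psi x) -> 0 <= density psi A.
Proof. by move=> psi0; apply: total_ge0 => x; rewrite mulr_ge0. Qed.

Lemma density_le psi A : finsupp psi -> (forall x, 0 <= psi x) ->
  density psi A <= total psi.
Proof.
move=> Fpsi psi0; apply: ler_total => //; first exact: finsupp_density.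
by move=> x; rewrite -[leRHS]mulr1 ler_wpM2l.
Qed.

Lemma densityU psi A B : finsupp psi -> A `&` B = set0 ->
  density psi (A `|` B) = density psi A + density psi B.
Proof.
move=> Fpsi AB0; rewrite /density -totalD; [|exact: finsupp_density..].
apply: eq_total => x; rewrite -mulrDr !indicE in_setU; congr (_ * _).
have [/set_mem Ax|_] := boolP (_ \in A); have [/set_mem Bx|_] := boolP (_ \in B).
- by have : (A `&` B) x^-1%g by []; rewrite AB0.
- by rewrite addr0.
- by rewrite add0r.
- by rewrite addr0.
Qed.

(** Reindexing by [x * g^-1] moves the translation from [A] to [psi]; the difference is then
    integrated against an indicator, with values in [[0, 1]]. *)
Lemma density_ltrans psi g A : finsupp psi ->
  `|density psi (ltrans g A) - density psi A| <=
    total (fun x => `|psi (x * g^-1)%g - psi x|).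
Proof.
move=> Fpsi.
have Fd : finsupp (fun x => psi (x * g^-1)%g + (-1) * psi x).
  by apply: finsuppD; [exact: finsuppS|exact: finsuppZ].
have Fn : finsupp (fun x => `|psi (x * g^-1)%g - psi x|).
  by apply: finsuppW Fd _ => x; rewrite mulN1r => ->; rewrite normr0.
have -> : density psi (ltrans g A) - density psi A =
    total (fun x => (psi (x * g^-1)%g + (-1) * psi x) * (\1_A (x^-1)%g : R)).
  rewrite /density -[- total _]mulN1r -totalZ.
  rewrite -(totalS g^-1%g (fun x => psi x * (\1_(ltrans g A) (x^-1)%g : R))).
  rewrite -totalD; first last.
  - by apply: finsuppZ; exact: finsupp_density.
  - by apply: (finsuppM _ (finsuppS g^-1%g Fpsi)).
  apply: eq_total => x; rewrite mulrDl mulrA; congr (_ * _ + _).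
  rewrite !indicE invgM invgK; congr ((_ : bool)%:R); apply/idP/idP.
    by rewrite !inE => -[a Aa /mulgI <-].
  by rewrite !inE => Ax; exists x^-1%g.
rewrite ler_norml; apply/andP; split.
  rewrite lerNl -[- total _]mulN1r -totalZ; apply: ler_total => //.
    by apply: finsuppZ; exact: finsuppM.
  move=> x; rewrite mulN1r indicE.
  case: (_ \in _); rewrite ?mulr1 ?mulr0 ?oppr0 // mulN1r.
  by rewrite -normrN ler_norm.
apply: ler_total => //; first exact: finsuppM.
move=> x; rewrite indicE; case: (_ \in _); rewrite ?mulr1 ?mulr0 // mulN1r.
exact: ler_norm.
Qed.

Lemma amenable_reiter :
  (forall (S : seq G) (eps : R), 0 < eps -> exists psi : G -> R,
    [/\ finsupp psi, forall x, 0 <= psi x, total psi = 1 &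
      forall s, s \in S -> total (fun x => `|psi (x * s)%g - psi x|) <= eps]) ->
  amenable R G.
Proof.
move=> reiter.
(* The tolerance for [S] is [1 / (size S + 1)], so it tends to [0] along long sequences. *)
have /choice[psi psiP] (S : seq G) := reiter S _ (harmonic_gt0 (size S)).
(* Sequences may repeat elements, so length can grow even when the group is finite. *)
pose B (T : seq G) := [set S : seq G | {subset T <= S} /\ (size T <= size S)%N].
have BF : ProperFilter (filter_from [set: seq G] B).
  apply: filter_from_proper; last by move=> T _; exists T; split.
  apply: filter_from_filter; first by exists [::].
  move=> S T _ _; exists (S ++ T) => // V [] sub; rewrite size_cat => le.
  split; split.
  - by move=> x xS; apply: sub; rewrite mem_cat xS.
  - by apply: leq_trans le; rewrite leq_addr.
  - by move=> x xT; apply: sub; rewrite mem_cat xT orbT.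
  - by apply: leq_trans le; rewrite leq_addl.
have [U [UU BU]] := ultraFilterLemma BF.
have bnd A S : 0 <= density (psi S) A <= 1.
  have [Fpsi psi0 psi1 _] := psiP S.
  by rewrite density_ge0 //= -psi1 density_le.
have /choice[m mP] A := ultra_bounded_cvg UU (bnd A).
exists m; split.
- apply: (cvg_unique _ (mP setT)) => //=.
  rewrite (_ : (fun _ => _) = fun=> 1); first exact: cvg_cst.
  by apply/funext => S; rewrite densityT; have [] := psiP S.
- move=> A; apply: (cvgr_to_ge (mP A)).
  by apply: filterE => S; case/andP: (bnd A S).
- move=> A A' AA'0; apply: (cvg_unique _ (mP (A `|` A'))) => //=.
  rewrite (_ : (fun _ => _) = fun S => density (psi S) A + density (psi S) A').
    exact: (cvgD (mP A) (mP A')).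
  by apply/funext => S; rewrite densityU //; have [] := psiP S.
- move=> g A; apply/eqP; rewrite -subr_eq0 -normr_le0.
  apply/ler_addgt0Pr => e e0; rewrite add0r.
  apply: (cvgr_to_le (cvg_norm (cvgB (mP (ltrans g A)) (mP A)))).
  have [N _ NP] := near_infty_natSinv_lt (PosNum e0).
  (* The head forces [g^-1] into [S]; the padding makes [S] long enough for a tolerance below
     [e]. *)
  apply: (filterS _ (BU _ (_ : filter_from setT B (B (g^-1%g :: nseq N 1%g))))).
    move=> S [sub]; rewrite /= size_nseq => leS.
    have [Fpsi psi0 psi1 inv] := psiP S.
    apply: le_trans (density_ltrans g A Fpsi) _.
    apply: le_trans (inv _ (sub _ (mem_head _ _))) _.
    by apply: ltW; apply: NP; exact: ltnW.
  by exists (g^-1%g :: nseq N 1%g).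
Qed.

End Reiter.

(** * Spectral gap on a non-amenable group *)

Lemma spectral_gap (R : realType) (G : groupType) : ~ amenable R G ->
  exists (S : seq G) (rho : R),
    [/\ 1%g \in S, perm_eq [seq s^-1%g | s <- S] S, 0 < rho < 1 &
      forall phi : G -> R, finsupp phi ->
        total (fun x => avg S phi x ^+ 2) <=
        rho ^+ 2 * total (fun x => phi x ^+ 2)].
Proof.
move=> namen; apply: contrapT => nogap; apply: namen.
apply: amenable_reiter => S eps eps0.
(* [T] is symmetric and contains the identity, so the assumed absence of a gap applies to it.
   Capping [eps] at [1] ensures [d <= 1]. *)
pose T : seq G := 1%g :: S ++ [seq s^-1%g | s <- S].
pose e := Num.min eps 1.
have e0 : 0 < e by rewrite lt_min eps0 ltr01.
have e1 : e <= 1 by rewrite ge_min lexx orbT.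
pose d := e ^+ 2 / (8 * (size T)%:R ^+ 2).
have k1 : 1 <= (size T)%:R ^+ 2 :> R by rewrite exprn_ege1 // ler1n.
have d0 : 0 < d.
  by rewrite divr_gt0 ?exprn_gt0 // mulr_gt0 // (lt_le_trans ltr01).
have d1 : d <= 1.
  rewrite ler_pdivrMr ?mulr_gt0 ?(lt_le_trans ltr01 k1) // mul1r.
  have : e ^+ 2 <= 1 by rewrite exprn_ile1 // ltW.
  by lra.
have symT : perm_eq [seq s^-1%g | s <- T] T.
  by rewrite /= invg1 perm_cons map_cat (mapK (@invgK G)) perm_catC.
have [phi [Fphi lt_avg]] : exists phi : G -> R, finsupp phi /\
    (1 - d) * total (fun x => phi x ^+ 2) < total (fun x => avg T phi x ^+ 2).
  (* With this [rho], [rho ^+ 2 = 1 - d + d ^+ 2 / 4] is at least [1 - d]. *)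
  apply: contrapT => nphi; apply: nogap; exists T, (1 - d / 2).
  split=> //; first exact: mem_head.
    by apply/andP; split; lra.
  move=> phi Fphi; rewrite leNgt; apply/negP => lt_avg; apply: nphi.
  exists phi; split=> //; apply: le_lt_trans lt_avg.
  rewrite ler_wpM2r //; first by apply: total_ge0 => x; exact: sqr_ge0.
  by have := sqr_ge0 d; lra.
have Fsq : finsupp (fun x => phi x ^+ 2).
  by apply: finsuppW Fphi _ => x ->; rewrite expr0n.
set a := total (fun x => phi x ^+ 2) in lt_avg.
(* If [phi] vanished, the strict inequality [lt_avg] would read [0 < 0]. *)
have a0 : 0 < a.
  have a_ge0 : 0 <= a by apply: total_ge0 => x; exact: sqr_ge0.
  rewrite lt_neqAle a_ge0 andbT eq_sym; apply/negP => /eqP a0.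
  have phi0 x : phi x = 0.
    apply/eqP; rewrite -sqrf_eq0 eq_le sqr_ge0 andbT -a0.
    by apply: (ler_total1 x Fsq) => y; exact: sqr_ge0.
  move: lt_avg; rewrite a0 mulr0 (eq_total (_ : _ =1 fun=> 0)).
    by rewrite (@total_seq _ _ [::]) // big_nil ltxx.
  by move=> x; rewrite /avg big1 ?mulr0 ?expr0n // => s _; rewrite phi0.
exists (fun x => a^-1 * phi x ^+ 2); split.
- exact: finsuppZ.
- by move=> x; rewrite mulr_ge0 ?sqr_ge0 // invr_ge0 ltW.
- by rewrite totalZ mulVf // gt_eqF.
move=> s sS; have sT : s \in T by rewrite inE mem_cat sS orbT.
have inv := almost_invariant_sqr Fphi (mem_head _ _) sT e0 (ltW lt_avg).
rewrite (eq_total (_ : _ =1 fun x => a^-1 * `|phi (x * s)%g ^+ 2 - phi x ^+ 2|)).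
  rewrite totalZ ler_pdivrMl //; apply: le_trans inv _.
  by rewrite mulrC ler_wpM2l ?(ltW a0) // ge_min lexx.
by move=> x; rewrite -mulrBr normrM gtr0_norm // invr_gt0.
Qed.

(** * The random walk with steps in [S] *)

Section RandomWalk.
Variables (R : realType) (G : groupType) (S : seq G).
Hypothesis S1 : 1%g \in S.
Hypothesis symS : perm_eq [seq s^-1%g | s <- S] S.

(** Counts, with multiplicity, the words of length [n] in [S] leading from [x] to [1]; for symmetric
    [S] this is also the number leading from [1] to [x]. *)
Fixpoint walks n (x : G) : nat :=
  if n is m.+1 then (\sum_(s <- S) walks m (x * s)%g)%N else (x == 1%g).

Definition walk_prob n x : R := (walks n x)%:R / (size S)%:R ^+ n.

Lemma size_gt0 : 0 < (size S)%:R :> R.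
Proof. by rewrite ltr0n; case: (S) S1. Qed.

(** Left and right multiplications commute, and [x * s = 1] exactly when [s * x = 1]. Inversion
    exchanges the two sides, so [walksV] needs this form. *)
Lemma walksSl n x : walks n.+1 x = (\sum_(s <- S) walks n (s * x)%g)%N.
Proof.
elim: n x => [|n IH] x.
  apply: eq_bigr => s _ /=; congr nat_of_bool.
  apply/eqP/eqP => xs.
    by rewrite -(mulKg x s) xs mulg1 mulVg.
  by rewrite -(mulKg s x) xs mulg1 mulVg.
transitivity (\sum_(s <- S) \sum_(t <- S) walks n (t * (x * s))%g)%N.
  by apply: eq_bigr => s _; exact: IH.
rewrite exchange_big; apply: eq_bigr => t _ /=.
by apply: eq_bigr => s _; rewrite mulgA.
Qed.

Lemma sum_inv (V : nmodType) (F : G -> V) :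
  \sum_(s <- S) F s^-1%g = \sum_(s <- S) F s.
Proof. by rewrite -[RHS](perm_big _ symS) big_map. Qed.

Lemma walksV n x : walks n x^-1%g = walks n x.
Proof.
elim: n x => [|n IH] x /=; first by rewrite invg_eq1.
rewrite -[RHS]/(walks n.+1 x) walksSl -(sum_inv (fun s => walks n (s * x)%g)).
by apply: eq_bigr => s _; rewrite -IH invgM invgK.
Qed.

Lemma walk_probV n x : walk_prob n x^-1%g = walk_prob n x.
Proof. by rewrite /walk_prob walksV. Qed.

Lemma walk_prob_ge0 n x : 0 <= walk_prob n x.
Proof. by rewrite divr_ge0 // exprn_ge0. Qed.

Lemma walk_prob0 x : walk_prob 0 x = (x == 1%g)%:R.
Proof. by rewrite /walk_prob expr0 divr1. Qed.

Lemma walk_probS n x : walk_prob n.+1 x = avg S (walk_prob n) x.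
Proof.
rewrite /walk_prob /avg -mulr_suml /= natr_sum exprSr invfM; ring.
Qed.

Lemma finsupp_walk_prob n : finsupp (walk_prob n).
Proof.
elim: n => [|n IH].
  exists [:: 1%g] => x; rewrite inE walk_prob0.
  by case: eqP.
by rewrite (_ : walk_prob n.+1 = avg S (walk_prob n));
  [exact: finsupp_avg|apply/funext => x; exact: walk_probS].
Qed.

(** Self-adjointness of averaging: substitute [x * s^-1] for [x] in each summand and use the
    symmetry of [S]. *)
Lemma total_walk_prob_mulS n (F : G -> R) :
  total (fun x => walk_prob n.+1 x * F x) =
  total (fun x => walk_prob n x * avg S F x).
Proof.
pose k : R := (size S)%:R.
have Fl (H : G -> R) s : finsupp (fun x => walk_prob n (x * s)%g * H x).
  by apply: (finsuppM _ (finsuppS s (finsupp_walk_prob n))).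
have Fr (H : G -> R) : finsupp (fun x => walk_prob n x * H x).
  by apply: finsuppM; exact: finsupp_walk_prob.
transitivity (k^-1 * \sum_(s <- S) total (fun x => walk_prob n (x * s)%g * F x)).
  rewrite -total_sum // -totalZ; apply: eq_total => x.
  by rewrite walk_probS /avg -mulrA mulr_suml.
transitivity (k^-1 * \sum_(s <- S) total (fun x => walk_prob n x * F (x * s)%g)).
  congr (_ * _).
  rewrite -(sum_inv (fun s => total (fun x => walk_prob n x * F (x * s)%g))).
  apply: eq_bigr => s _.
  rewrite -(totalS s^-1%g); apply: eq_total => x.
  by rewrite mulgVK.
rewrite -total_sum // -totalZ; apply: eq_total => x.
by rewrite /avg [RHS]mulrCA; congr (_ * _); rewrite mulr_sumr.
Qed.

Lemma total_walk_prob0_mul (F : G -> R) :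
  total (fun x => walk_prob 0 x * F x) = F 1%g.
Proof.
rewrite (@total_seq _ _ [:: 1%g]) //.
  by rewrite big_seq1 walk_prob0 eqxx mul1r.
by move=> x; rewrite inE walk_prob0 => /negPf ->; rewrite mul0r.
Qed.

Lemma total_walk_prob n : total (walk_prob n) = 1.
Proof.
rewrite (eq_total (_ : _ =1 fun x => walk_prob n x * 1)); last first.
  by move=> x; rewrite mulr1.
elim: n => [|n IH]; first by rewrite total_walk_prob0_mul.
rewrite total_walk_prob_mulS -[RHS]IH; apply: eq_total => x.
rewrite /avg big_const_seq count_predT iter_addr_0 mulVf //.
by rewrite gt_eqF // size_gt0.
Qed.

(** Each step of the walk is moved onto [F] and costs a factor [r]; after [n] steps only the point
    mass at [1] remains. *)
Lemma walk_prob_superharmonic (r : R) (F : G -> R) n :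
  0 <= r -> (forall x, 0 <= F x) -> (forall x, avg S F x <= r * F x) ->
  total (fun x => walk_prob n x * F x) <= r ^+ n * F 1%g.
Proof.
move=> r0 F0 avgF; elim: n => [|n IH].
  by rewrite total_walk_prob0_mul expr0 mul1r.
rewrite total_walk_prob_mulS exprS -mulrA.
apply: le_trans (ler_wpM2l r0 IH); rewrite -totalZ; apply: ler_total.
- by apply: finsuppM; exact: finsupp_walk_prob.
- by apply: finsuppZ; apply: finsuppM; exact: finsupp_walk_prob.
by move=> x; rewrite [leRHS]mulrCA ler_wpM2l // walk_prob_ge0.
Qed.

(** A nonzero number of walks is at least one. *)
Lemma walk_prob_ge n x : walk_prob n x != 0 -> (size S)%:R ^- n <= walk_prob n x.
Proof.
rewrite /walk_prob; case: (walks n x) => [|m _]; first by rewrite mul0r eqxx.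
by rewrite ler_peMl ?ler1n // invr_ge0 exprn_ge0.
Qed.

(** The gap is iterated from the point mass at [1], of norm one, and a value is at most the
    [l^2]-norm. *)
Lemma walk_prob_le (rho : R) n x : 0 <= rho ->
  (forall phi : G -> R, finsupp phi ->
     total (fun x => avg S phi x ^+ 2) <= rho ^+ 2 * total (fun x => phi x ^+ 2)) ->
  walk_prob n x <= rho ^+ n.
Proof.
move=> rho0 gap.
have : total (fun x => walk_prob n x ^+ 2) <= (rho ^+ n) ^+ 2.
  elim: n => [|n IH].
    rewrite (eq_total (_ : _ =1 fun x => walk_prob 0 x * walk_prob 0 x)) //.
    by rewrite total_walk_prob0_mul walk_prob0 eqxx expr0 expr1n.
  rewrite (eq_total (_ : _ =1 fun x => avg S (walk_prob n) x ^+ 2)); last first.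
    by move=> y; rewrite walk_probS.
  apply: le_trans (gap _ (finsupp_walk_prob n)) _.
  by rewrite (exprS rho n) exprMn ler_wpM2l // sqr_ge0.
move=> le_sq; rewrite -(@ler_pXn2r _ 2) ?nnegrE ?walk_prob_ge0 ?exprn_ge0 //.
apply: le_trans le_sq; apply: (@ler_total1 _ _ x (fun x => walk_prob n x ^+ 2)).
  by apply: finsuppW (finsupp_walk_prob n) _ => y ->; rewrite expr0n.
by move=> y; exact: sqr_ge0.
Qed.

End RandomWalk.

(** * Green functions of the walk *)

Section Green.
Local Open Scope classical_set_scope.
Local Open Scope ring_scope.
Variables (R : realType) (G : groupType) (S : seq G) (rho : R).
Hypothesis S1 : 1%g \in S.
Hypothesis symS : perm_eq [seq s^-1%g | s <- S] S.
Hypothesis rho0 : 0 < rho.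
Hypothesis decay : forall n x, walk_prob R S n x <= rho ^+ n.

Definition green_term (q : R) (x : G) : R^nat :=
  fun n => q ^- n * walk_prob R S n x.

(** The Green function at parameter [1/q]; for [rho < q] the series converges by comparison with the
    geometric series of ratio [rho / q]. *)
Definition green (q : R) (x : G) : R := limn (series (green_term q x)).

Lemma green_term_ge0 q x n : 0 <= q -> 0 <= green_term q x n.
Proof. by move=> q0; rewrite mulr_ge0 ?invr_ge0 ?exprn_ge0 ?walk_prob_ge0. Qed.

Lemma cvg_green q x : rho < q -> series (green_term q x) @ \oo --> green q x.
Proof.
move=> rq; have q0 : 0 < q by exact: lt_trans rq.
apply: (@series_le_cvg _ _ (geometric 1 (rho / q))).
- by move=> n; apply: green_term_ge0; exact: ltW.
- by move=> n; rewrite /= mul1r exprn_ge0 // divr_ge0 // ltW.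
- move=> n; rewrite /green_term /= mul1r expr_div_n mulrC ler_wpM2r //.
  by rewrite invr_ge0 exprn_ge0 // ltW.
apply: is_cvg_geometric_series.
by rewrite gtr0_norm ?divr_gt0 // ltr_pdivrMr // mul1r.
Qed.

Lemma series_green_le q x N : rho < q ->
  series (green_term q x) N <= green q x.
Proof.
move=> rq; apply: nondecreasing_cvgn_le; last first.
  by apply/cvg_ex; exists (green q x); exact: cvg_green.
apply: nondecreasing_series => n _ _; apply: green_term_ge0.
by rewrite ltW // (lt_trans rho0).
Qed.

Lemma green_term_le q x n : rho < q -> green_term q x n <= green q x.
Proof.
move=> rq; apply: le_trans (series_green_le x n.+1 rq).
rewrite /series /= big_nat_recr //= lerDr sumr_ge0 // => i _.
by rewrite green_term_ge0 // ltW // (lt_trans rho0).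
Qed.

Lemma greenV q x : green q x^-1%g = green q x.
Proof.
rewrite /green; congr (limn (series _)); apply/funext => n.
by rewrite /green_term walk_probV.
Qed.

Lemma cvg_sum_seq (I : Type) (s : seq I) (f : I -> R^nat) (l : I -> R) :
  (forall i, f i @ \oo --> l i) ->
  (fun n => \sum_(i <- s) f i n) @ \oo --> \sum_(i <- s) l i.
Proof.
move=> fl; elim: s => [|i s IH].
  rewrite big_nil (_ : (fun _ => _) = fun=> 0); first exact: cvg_cst.
  by apply/funext => n; rewrite big_nil.
rewrite big_cons (_ : (fun _ => _) = fun n => f i n + \sum_(j <- s) f j n).
  exact: cvgD.
by apply/funext => n; rewrite big_cons.
Qed.

Lemma avg_green_le q x : rho < q -> avg S (green q) x <= q * green q x.
Proof.
move=> rq; have q0 : 0 < q by exact: lt_trans rq.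
have := @cvg_sum_seq _ S _ _ (fun s => @cvg_green q (x * s)%g rq).
move=> /(@cvgMl_tmp _ _ _ _ _ (size S)%:R^-1)/cvgr_to_le; apply.
apply: nearW => N.
(* Averaging turns the term of index [n] into [q] times the term of index [n.+1], hence [N.+1]; the
   extra term of index [0] is nonnegative. *)
apply: (@le_trans _ _ (q * series (green_term q x) N.+1)).
  rewrite /series /= big_nat_recl //= mulrDr -[leLHS]add0r lerD //.
    by rewrite mulr_ge0 ?green_term_ge0 // ltW.
  rewrite exchange_big /= !mulr_sumr le_eqVlt; apply/orP; left; apply/eqP.
  apply: eq_bigr => n _.
  rewrite /green_term walk_probS /avg -mulr_sumr exprSr.
  by rewrite mulrCA; field; rewrite ?expf_neq0 ?gt_eqF // size_gt0.
by rewrite ler_wpM2l ?series_green_le // ltW.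
Qed.

(** By [walk_prob_superharmonic] the terms of index [n] contribute at most [(r / q) ^+ n * F 1], and
    these add up to a geometric series. *)
Lemma sum_green_mul_le (q r : R) (F : G -> R) (X : seq G) :
  rho < q -> 0 <= r < q -> uniq X -> (forall x, 0 <= F x) ->
  (forall x, avg S F x <= r * F x) ->
  \sum_(x <- X) green q x * F x <= F 1%g / (1 - r / q).
Proof.
move=> rq /andP[r0 ltrq] uX F0 avgF; have q0 : 0 < q by exact: lt_trans rq.
have cX : (fun N => \sum_(x <- X) (series (green_term q x) N * F x)) @ \oo -->
    \sum_(x <- X) green q x * F x.
  by apply: cvg_sum_seq => x; apply: cvgMr_tmp; exact: cvg_green.
apply: (cvgr_to_le cX); apply: nearW => N.
have rq1 : `|r / q| < 1.
  by rewrite ger0_norm ?divr_ge0 ?(ltW q0) // ltr_pdivrMr // mul1r.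
apply: (@le_trans _ _ (series (geometric (F 1%g) (r / q)) N)).
  rewrite (eq_bigr (fun x => \sum_(0 <= n < N) (green_term q x n * F x))).
    rewrite exchange_big /=; apply: ler_sum => n _.
    rewrite (eq_bigr (fun x => q ^- n * (walk_prob R S n x * F x))); last first.
      by move=> x _; rewrite /green_term -mulrA.
    rewrite -mulr_sumr mulrC /geometric /= expr_div_n mulrA ler_wpM2r //.
      by rewrite invr_ge0 exprn_ge0 // ltW.
    rewrite [leRHS]mulrC.
    apply: le_trans _ (walk_prob_superharmonic symS n r0 F0 avgF).
    apply: ler_sum_total => //.
      by apply: finsuppM; exact: finsupp_walk_prob.
    by move=> x; rewrite mulr_ge0 // walk_prob_ge0.
  by move=> x _; rewrite /= mulr_suml.
rewrite -(cvg_lim _ (@cvg_geometric_series _ (F 1%g) _ rq1)) //.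
apply: nondecreasing_cvgn_le; last exact: is_cvg_geometric_series.
by apply: nondecreasing_series => n _ _ /=; rewrite mulr_ge0 ?exprn_ge0 ?divr_ge0 //
  ltW.
Qed.

End Green.

(** * The Green function is a Littlewood function outside some [l^p] *)

Section LittlewoodFunction.
Local Open Scope classical_set_scope.
Local Open Scope ring_scope.
Variables (R : realType) (G : groupType) (S : seq G) (rho : R).
Hypothesis S1 : 1%g \in S.
Hypothesis symS : perm_eq [seq s^-1%g | s <- S] S.
Hypothesis rho0 : 0 < rho.
Hypothesis decay : forall n x, walk_prob R S n x <= rho ^+ n.

(** For symmetric [S], this is the subgroup generated by [S]. *)
Definition reachable (x : G) := exists n, (0 < walks S n x)%N.

Lemma reachable1 : reachable 1%g.
Proof. by exists 0; rewrite /= eqxx. Qed.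

Lemma gen_inv s : s \in S -> s^-1%g \in S.
Proof. by move=> sS; rewrite -(perm_mem symS); apply: map_f. Qed.

Lemma reachableM x s : s \in S -> reachable x -> reachable (x * s)%g.
Proof.
move=> sS [n n0]; exists n.+1 => /=.
rewrite (big_rem s^-1%g) ?gen_inv //= mulgK.
by rewrite addn_gt0 n0.
Qed.

Lemma reachableMV x s : s \in S -> reachable (x * s)%g -> reachable x.
Proof. by move=> sS /(reachableM (gen_inv sS)); rewrite mulgK. Qed.

(* [S] need not generate the group and [green r] vanishes off the subgroup it
   generates, so [green r] is moved to every left coset of that subgroup. *)
Definition coset_base (x : G) : G :=
  xget 1%g [set y : G | reachable (y^-1 * x)%g].

Lemma reachable_base x : reachable ((coset_base x)^-1 * x)%g.
Proof.
(* [x] lies in its own coset, so [xget] never falls back on its default. *)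
by apply: (@xgetPex _ 1%g [set y | reachable (y^-1 * x)%g]); exists x;
  rewrite /= mulVg; exact: reachable1.
Qed.

Lemma coset_baseM x s : s \in S -> coset_base (x * s)%g = coset_base x.
Proof.
move=> sS; rewrite /coset_base; congr (xget _ _).
apply/seteqP; split=> y /=; rewrite mulgA; first exact: reachableMV.
exact: reachableM.
Qed.

Definition superharmonic (r : R) (x : G) : R :=
  green S r ((coset_base x)^-1 * x)%g.

(** At a reachable point some term of the series is positive. Positivity everywhere permits division
    by [h x] in [sum_green_dominated]. *)
Lemma superharmonic_gt0 r x : rho < r -> 0 < superharmonic r x.
Proof.
move=> rr; have [n n0] := reachable_base x.
apply: lt_le_trans (green_term_le rho0 decay _ n rr).
have r0 : 0 < r by exact: lt_trans rr.
by rewrite mulr_gt0 ?invr_gt0 ?exprn_gt0 // divr_gt0 ?ltr0n ?exprn_gt0 // size_gt0.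
Qed.

Lemma avg_superharmonic r x : rho < r ->
  avg S (superharmonic r) x <= r * superharmonic r x.
Proof.
move=> rr; apply: le_trans (avg_green_le S1 rho0 decay _ rr).
rewrite /avg le_eqVlt; apply/orP; left; apply/eqP; congr (_ * _).
apply: eq_big_seq => s sS.
by rewrite /superharmonic coset_baseM // mulgA.
Qed.

(** Multiply by [h x], replace it by the larger [h y] on [P], and extend the sum to all of [Y];
    [sum_green_mul_le] bounds the result by [h x / (1 - r / q)]. *)
Lemma sum_green_dominated (q r : R) (x : G) (P : pred G) (Y : seq G) :
  rho < r -> r < q -> uniq Y ->
  (forall y, P y -> superharmonic r x <= superharmonic r y) ->
  \sum_(y <- Y | P y) green S q (x^-1 * y)%g <= (1 - r / q)^-1.
Proof.
move=> rr rq uY Phy; pose h := superharmonic r.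
have q0 : 0 < q by rewrite (lt_trans rho0) // (lt_trans rr).
have g0 z : 0 <= green S q z.
  apply: le_trans (green_term_le rho0 decay z 0 (lt_trans rr rq)).
  by apply: green_term_ge0; exact: ltW.
have h0 z : 0 < h z by exact: superharmonic_gt0.
rewrite -(@ler_pM2l _ (h x)) // mulr_sumr.
apply: (@le_trans _ _ (\sum_(y <- Y) green S q (x^-1 * y)%g * h y)).
  rewrite [leRHS](bigID P) /= -[leLHS]addr0 lerD //; last first.
    by apply: sumr_ge0 => y _; rewrite mulr_ge0 // ltW.
  by apply: ler_sum => y Py; rewrite mulrC ler_wpM2l // Phy.
(* Left translation commutes with averaging on the right, so [F] satisfies the same inequality as
   [h]. *)
pose F z := h (x * z)%g.
have -> : \sum_(y <- Y) green S q (x^-1 * y)%g * h y =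
    \sum_(z <- [seq (x^-1 * y)%g | y <- Y]) green S q z * F z.
  by rewrite big_map; apply: eq_bigr => y _; rewrite /F mulVKg.
have <- : F 1%g = h x by rewrite /F mulg1.
apply: (sum_green_mul_le symS rho0 decay).
- exact: lt_trans rq.
- by rewrite rq andbT ltW // (lt_trans rho0).
- by rewrite map_inj_uniq //; exact: mulgI.
- by move=> z; apply: ltW; exact: h0.
move=> z; apply: le_trans (avg_superharmonic _ rr).
rewrite /avg le_eqVlt; apply/orP; left; apply/eqP; congr (_ * _).
by apply: eq_bigr => s _; rewrite /F mulgA.
Qed.

Lemma cmod_real (a : R) : 0 <= a -> cmod (a%:C)%C = a.
Proof. by move=> a0; rewrite /cmod /= expr0n addr0 sqrtr_sqr ger0_norm. Qed.

Lemma esum_le_seq (a : G -> R) (C : R) :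
  (forall Y : seq G, uniq Y -> \sum_(y <- Y) a y <= C) ->
  (\esum_(y in [set: G]) (a y)%:E <= C%:E)%E.
Proof.
move=> aC; rewrite /esum ge_ereal_sup //= => _ [A [finA _] <-].
by rewrite fsbig_finite // sumEFin lee_fin; apply: aC; exact: finmap.fset_uniq.
Qed.

Lemma littlewood_green (q r : R) : rho < r -> r < q ->
  littlewood (fun x : G => (green S q x)%:C%C).
Proof.
move=> rr rq; pose h := superharmonic r.
have q0 : 0 < q by rewrite (lt_trans rho0) // (lt_trans rr).
have g0 z : 0 <= green S q z.
  apply: le_trans (green_term_le rho0 decay z 0 (lt_trans rr rq)).
  by apply: green_term_ge0; exact: ltW.
exists (fun x y => if h x <= h y then (green S q (x^-1 * y)%g)%:C%C else 0).
exists (fun x y => if h y < h x then (green S q (x^-1 * y)%g)%:C%C else 0).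
have cmodE (b : bool) z :
    cmod (if b then (green S q z)%:C%C else 0) = if b then green S q z else 0.
  by case: b; rewrite cmod_real.
split.
- by move=> x y; case: leP => _; rewrite ?addr0 ?add0r.
- exists (1 - r / q)^-1 => x; apply: esum_le_seq => Y uY.
  under eq_bigr do rewrite cmodE.
  by rewrite -big_mkcond /=; exact: sum_green_dominated.
exists (1 - r / q)^-1 => y; apply: esum_le_seq => Y uY.
(* Symmetry of the Green function exchanges [x] and [y], turning the column sum into a row sum. *)
under eq_bigr do rewrite cmodE -greenV // invgM invgK.
rewrite -big_mkcond /=; apply: sum_green_dominated => // x.
exact: ltW.
Qed.

Lemma green_not_in_lp (q t : R) : rho < q -> q < 1 -> 0 <= t ->
  q < (size S)%:R^-1 `^ t ->
  ~ in_lp (1 + t) (fun x : G => (green S q x)%:C%C).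
Proof.
move=> rq q1 t0 qk; have q0 : 0 < q by exact: lt_trans rq.
pose b := q^-1 * (size S)%:R^-1 `^ t.
have b1 : 1 < b by rewrite /b mulrC ltr_pdivlMr // mul1r.
have b0 : 0 < b by exact: lt_trans b1.
have g0 z : 0 <= green S q z.
  apply: le_trans (green_term_le rho0 decay z 0 rq).
  by apply: green_term_ge0; exact: ltW.
rewrite /in_lp; set E := (X in (X < _)%E) => finE.
(* Write [v] for the term of index [n]: [v ^ (1 + t) = v * v ^ t], and where the walk has positive
   probability [v >= k^-n] because [q < 1]. *)
have term_le n x :
    b ^+ n * walk_prob R S n x <= cmod (green S q x)%:C%C `^ (1 + t).
  rewrite cmod_real //.
  have [->|u0] := eqVneq (walk_prob R S n x) 0; first by rewrite mulr0 powR_ge0.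
  have u_gt0 : 0 < walk_prob R S n x by rewrite lt_neqAle eq_sym u0 walk_prob_ge0.
  have v0 : 0 < green_term S q x n by rewrite mulr_gt0 ?invr_gt0 ?exprn_gt0.
  have p0 : 0 <= 1 + t by rewrite addr_ge0.
  apply: (@le_trans _ _ (green_term S q x n `^ (1 + t))); last first.
    apply: ge0_ler_powR; rewrite ?nnegrE ?(ltW v0) //.
    exact: (green_term_le rho0 decay).
  rewrite powRD; last by rewrite (gt_eqF v0) implybT.
  rewrite powRr1 ?(ltW v0) //.
  have -> : b ^+ n * walk_prob R S n x =
      green_term S q x n * ((size S)%:R^-1 `^ t) ^+ n.
    by rewrite /b /green_term exprMn exprVn; ring.
  rewrite ler_wpM2l ?(ltW v0) //.
  rewrite -powR_mulrn ?powR_ge0 // -powRrM mulrC powRrM powR_mulrn ?invr_ge0 //.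
  apply: ge0_ler_powR; rewrite ?nnegrE ?(ltW v0) ?exprn_ge0 ?invr_ge0 //.
  rewrite exprVn; apply: le_trans (walk_prob_ge u0) _.
  by rewrite ler_peMl ?(ltW u_gt0) // invf_ge1 ?exprn_gt0 // exprn_ile1 // ltW.
(* Sum [term_le] over the support of the [n]-step distribution, whose total mass is [1]. *)
have leE n : ((b ^+ n)%:E <= E)%E.
  have [X uX uX0] := finsupp_uniq (finsupp_walk_prob R S n).
  apply: esum_ge; exists [set` X]; first by split=> //; exact: finite_seq.
  rewrite -fsbig_seq // sumEFin lee_fin.
  rewrite -[leLHS]mulr1 -[X in _ * X <= _](total_walk_prob R S1 symS n).
  rewrite (total_seq uX uX0).
  by rewrite mulr_sumr; apply: ler_sum => x _; exact: term_le.
have E0 : (0 <= E)%E by apply: le_trans (leE 0); rewrite lee_fin.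
have Efin : E \is a fin_num by rewrite ge0_fin_numE.
have bnd n : b ^+ n <= fine E by rewrite -lee_fin fineK.
have c0 : 0 < fine E by apply: lt_le_trans (bnd 0); rewrite expr0.
(* The powers of [b^-1] tend to [0] but stay above [(fine E)^-1]. *)
have : (fine E)^-1 <= 0.
  have vb1 : `|b^-1| < 1 by rewrite gtr0_norm ?invr_gt0 // invf_lt1.
  apply: (cvgr_to_ge (cvg_expr vb1)); apply: nearW => n /=.
  by rewrite exprVn lef_pV2 ?posrE ?exprn_gt0.
by rewrite leNgt invr_gt0 c0.
Qed.

End LittlewoodFunction.

(** * Choice of the exponent and of the parameters *)

Lemma exists_small_exponent (R : realType) (q k : R) : 0 < q < 1 -> 1 <= k ->
  exists2 t, 0 < t & q < k^-1 `^ t.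
Proof.
move=> /andP[q0 q1] k1; have k0 : 0 < k by exact: lt_le_trans k1.
have lq : 0 < - ln q by rewrite oppr_gt0 ln_lt0 // q0.
have lk : 0 <= ln k by rewrite ln_ge0.
have den : 0 < ln k + 1 by rewrite ltr_wpDl.
(* After taking logarithms the condition is [t * ln k < - ln q]; the added [1] gives strictness and
   covers [k = 1]. *)
exists (- ln q / (ln k + 1)); first by rewrite divr_gt0.
rewrite -ltr_ln ?posrE ?powR_gt0 ?invr_gt0 //.
rewrite ln_powR lnV ?posrE // mulrN ltrNr mulrAC ltr_pdivrMr //.
by rewrite ltr_pM2l // ltrDl.
Qed.

Theorem theorem1p1 (R : realType) (G : groupType) :
  ~ amenable R G ->
  exists p : R, 1 < p /\
    exists f : G -> R[i], littlewood f /\ ~ in_lp p f.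
Proof.
move=> /spectral_gap[S [rho [S1 symS /andP[rho0 rho1] gap]]].
have decay n x : walk_prob R S n x <= rho ^+ n.
  exact: walk_prob_le n x (ltW rho0) gap.
(* These points cut the interval from [rho] to [1] into thirds. *)
pose r := (2 * rho + 1) / 3; pose q := (rho + 2) / 3.
have rr : rho < r by rewrite /r; lra.
have rq : r < q by rewrite /r /q; lra.
have q1 : q < 1 by rewrite /q; lra.
have q0 : 0 < q by rewrite /q; lra.
have k1 : 1 <= (size S)%:R :> R by rewrite ler1n -(ltr0n R); exact: size_gt0.
have [|t t0 qk] := @exists_small_exponent _ q _ _ k1; first by rewrite q0.
exists (1 + t); split; first by rewrite ltrDl.
exists (fun x => (green S q x)%:C%C); split; first exact: littlewood_green rr rq.
by apply: (green_not_in_lp S1 _ rho0 decay (lt_trans rr rq) q1 (ltW t0) qk).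
Qed.
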